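(* Let $\Gamma$ be a finitely generated group with a splitting $\Gamma=A\ast B$ into two non-trivial groups, such that $A$ contains an element of infinite order. Then for any finite-dimensional Banach $\Gamma$-module $E$, the split classes form an infinite-dimensional subspace of $\mathrm{H}^2_\mathrm{b}(\Gamma,E)$.
   Context: A Banach $\Gamma$-module is a Banach space $E$ with a linear isometric $\Gamma$-action $g.v$. A quasicocycle is a map $f:\Gamma\to E$ with $\sup_{g,h}\|f(gh)-f(g)-g.f(h)\|<\infty$; it is alternating if $f(g)+g.f(g^{-1})=0$ for all $g$; $\mathrm{Q}\mathcal{Z}_{\mathrm{alt}}(\Gamma,E)$ denotes the alternating quasicocycles. $\mathrm{H}^*_\mathrm{b}(\Gamma,E)$ is the cohomology of the bounded bar complex $\ell^\infty(\Gamma^k,E)$ with the usual inhomogeneous coboundary; for a quasicocycle $f$, $\partial f(g,h)=f(g)+g.f(h)-f(gh)$ is a bounded 2-cocycle and $\omega_f:=[\partial f]_\mathrm{b}\in\mathrm{H}^2_\mathrm{b}(\Gamma,E)$. Each $1\neq g\in A\ast B$ has a unique normal form $g=a_1b_1\cdots a_nb_n$ ($a_i\in A$, $b_i\in B$, all non-trivial except possibly $a_1$ or $b_n$). For $f_A\in\mathrm{Q}\mathcal{Z}_{\mathrm{alt}}(A,E)$, $f_B\in\mathrm{Q}\mathcal{Z}_{\mathrm{alt}}(B,E)$ the split quasicocycle is $f_A\ast f_B(1)=0$, $(f_A\ast f_B)(a_1b_1\cdots a_nb_n)=f_A(a_1)+a_1.f_B(b_1)+a_1b_1.f_A(a_2)+\dots+a_1b_1\cdots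 b_{n-1}a_n.f_B(b_n)$. The split classes (for the splitting $A\ast B$) are the classes $\omega_{f_A\ast f_B}$; they form the image of the linear map $(f_A,f_B)\mapsto\omega_{f_A\ast f_B}$.
   Formalization: The module E is assumed to be nonzero; for E = 0 the second bounded cohomology vanishes, so the claim as worded fails. *)

(* Defs.v *)
From HB Require Import structures.
From mathcomp Require Import all_boot all_order all_algebra.
From mathcomp Require Import monoid.
From mathcomp Require Import all_classical all_reals all_analysis.

Set Implicit Arguments.
Unset Strict Implicit.
Unset Printing Implicit Defensive.

Import Order.TTheory GRing.Theory Num.Theory.
Import numFieldNormedType.Exports.
Local Open Scope ring_scope.

Section BoundedCohomologyDefs.
Variables (R : realType) (G : groupType) (E : normedModType R).

Definition finitely_generated : Prop :=
  exists S : seq G, forall g : G, exists w : seq (G * bool),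
    all (fun p => p.1 \in S) w /\
    g = foldr (fun p acc => ((if p.2 then p.1 else p.1^-1) * acc)%g) 1%g w.

Definition is_subgroup (A : set G) : Prop :=
  A 1%g /\ (forall x y, A x -> A y -> A (x * y)%g) /\ (forall x, A x -> A x^-1%g).

Definition nontrivial_subgroup (A : set G) : Prop := exists a, A a /\ a <> 1%g.

Definition has_infinite_order_element (A : set G) : Prop :=
  exists a, A a /\ forall n : nat, (0 < n)%N -> (a ^+ n)%g <> 1%g.

Definition nf_prod (w : seq (G * G)) : G :=
  foldr (fun p acc => (p.1 * (p.2 * acc))%g) 1%g w.

Definition is_normal_form (A B : set G) (w : seq (G * G)) : Prop :=
  w <> [::] /\
  (forall i, (i < size w)%N -> A (nth (1, 1)%g w i).1 /\ B (nth (1, 1)%g w i).2) /\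
  (forall i, (0 < i < size w)%N -> (nth (1, 1)%g w i).1 <> 1%g) /\
  (forall i, (i.+1 < size w)%N -> (nth (1, 1)%g w i).2 <> 1%g).

Definition free_product_splitting (A B : set G) : Prop :=
  is_subgroup A /\ is_subgroup B /\
  forall g : G, g <> 1%g -> exists! w, is_normal_form A B w /\ nf_prod w = g.

Definition linear_isometric_action (act : G -> E -> E) : Prop :=
  (forall g (c : R) (u v : E), act g (c *: u + v) = c *: act g u + act g v) /\
  (forall g (v : E), `|act g v| = `|v|) /\
  (forall v : E, act 1%g v = v) /\
  (forall g h (v : E), act (g * h)%g v = act g (act h v)).

Definition finite_dimensional : Prop :=
  exists s : seq E, forall v : E, exists c : nat -> R,
    v = \sum_(i < size s) c i *: nth 0 s i.

Definition cobound1 (act : G -> E -> E) (f : G -> E) (g h : G) : E :=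
  f g + act g (f h) - f (g * h)%g.

Definition bounded1 (f : G -> E) : Prop := exists M : R, forall g, `|f g| <= M.

(** Quasicocycles / alternating quasicocycles of the subgroup A (with the
    restricted action); the values of f outside A are irrelevant. *)
Definition quasicocycle_on (A : set G) (act : G -> E -> E) (f : G -> E) : Prop :=
  exists M : R, forall g h, A g -> A h -> `|cobound1 act f g h| <= M.

Definition alt_quasicocycle_on (A : set G) (act : G -> E -> E) (f : G -> E) : Prop :=
  quasicocycle_on A act f /\ forall g, A g -> f g + act g (f g^-1%g) = 0.

Fixpoint nf_sum_from (act : G -> E -> E) (fA fB : G -> E) (h : G)
    (w : seq (G * G)) : E :=
  match w with
  | [::] => 0
  | p :: w' => act h (fA p.1) + act (h * p.1)%g (fB p.2)
               + nf_sum_from act fA fB (h * p.1 * p.2)%g w'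
  end.

Definition nf_sum act fA fB w := nf_sum_from act fA fB 1%g w.

(** F is the split quasicocycle f_A * f_B (well defined by uniqueness of
    normal forms). *)
Definition is_split_quasicocycle (A B : set G) (act : G -> E -> E)
    (fA fB F : G -> E) : Prop :=
  F 1%g = 0 /\
  forall w, is_normal_form A B w -> nf_prod w <> 1%g ->
    F (nf_prod w) = nf_sum act fA fB w.

End BoundedCohomologyDefs.

(* Main.v *)
(* Suppose that a linear combination F of split quasicocycles with bounded f_A and f_B = 0
   has the same defect as a bounded function beta.  The defect of F vanishes on pairs of
   words that concatenate to a reduced word, so beta is additive there.  If h moves every
   unit vector by at most d and all its powers are reduced, then |beta(h^n) - n beta(h)| is at
   most n d M, hence |beta(h)| <= d M.  For h = a^(+-1) b a b^-1 with a close to the identity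
   on E, this bounds both beta(a) + b beta(a) and -beta(a) + b beta(a), so that beta(a) is
   small.  As E is finite-dimensional, the powers of an element of infinite order of A come
   back arbitrarily close to the identity, along exponents n_j that can be chosen with
   n_(j+1) > 2 n_j.  Let the i-th function f_A be the alternating function supported on the
   a^(+-n_j) with j = i mod k: then the defect of F at (a^n, a^n) with n = n_j is
   c_i (v + a^n v), which is about 2 c_i v, while it is small as the defect of beta. *)

Require Import Defs.
From HB Require Import structures.
From mathcomp Require Import all_boot all_order all_algebra.
From mathcomp Require Import monoid.
From mathcomp Require Import ring.
From mathcomp Require Import all_classical all_reals all_analysis.
Import Order.TTheory GRing.Theory Num.Theory.
Import numFieldNormedType.Exports.
Local Open Scope classical_set_scope.
Local Open Scope ring_scope.

Set Implicit Arguments.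
Unset Strict Implicit.
Unset Printing Implicit Defensive.

(** * Reduced words in a free product and their normal forms *)

Section ReducedWords.
Variables (G : groupType) (A B : set G).
Implicit Types (p q : bool * G) (l t : seq (bool * G)) (w : seq (G * G)).

Definition factor (s : bool) : set G := if s then A else B.

Definition letter p : bool := (p.2 \in factor p.1) && (p.2 != 1%g).

Definition alternates p q : bool := p.1 != q.1.

(** Tagged letters replace the pairs of a normal form because such words can be cut and concatenated
    at any letter. *)
Definition reduced l : bool := all letter l && sorted alternates l.

Definition word_prod l : G := foldr (fun p g => (p.2 * g)%g) 1%g l.

Lemma word_prod_cat l t : word_prod (l ++ t) = (word_prod l * word_prod t)%g.
Proof. by elim: l => [|p l IH] /=; rewrite ?mul1g// IH mulgA. Qed.

Lemma word_prod_rcons l p : word_prod (rcons l p) = (word_prod l * p.2)%g.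
Proof. by rewrite -cats1 word_prod_cat /= mulg1. Qed.

Lemma reduced_cons p l :
  reduced (p :: l) = [&& letter p, reduced l & (if l is q :: _ then alternates p q else true)].
Proof.
by rewrite /reduced; case: l => [|q l] /=; rewrite ?andbT// -!andbA;
  do ?bool_congr; rewrite andbC -!andbA; do ?bool_congr; rewrite andbC.
Qed.

Lemma reduced_cat l t : reduced (l ++ t) -> reduced l /\ reduced t.
Proof.
rewrite /reduced all_cat => /andP[/andP[-> ->]] /=.
case: l => //= p l; rewrite cat_path => /andP[-> /=].
by case: t => //= q t /andP[_ ->].
Qed.

Lemma reduced_rcons_cat l p q t : reduced (rcons l p) -> reduced (q :: t) ->
  alternates p q -> reduced (rcons l p ++ q :: t).
Proof.
rewrite /reduced all_cat => /andP[-> sl] /andP[-> st] apq /=.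
by case: l sl => [|r l] /= sl; rewrite ?apq//= cat_path sl last_rcons /= apq.
Qed.

(* The letter [(true, a)] is fused with a following B-letter: the normal form of the
   remaining word then has trivial first component. *)
Definition pair_letter p w : seq (G * G) :=
  if p.1 then
    if w is (x, b) :: w' then if x == 1%g then (p.2, b) :: w' else (p.2, 1%g) :: w
    else [:: (p.2, 1%g)]
  else (1%g, p.2) :: w.

Definition pair_up l : seq (G * G) := foldr pair_letter [::] l.

Lemma nf_prod_pair_up l : nf_prod (pair_up l) = word_prod l.
Proof.
elim: l => //= -[[] x] l <-; rewrite /pair_letter /=; last by rewrite mul1g.
case: (pair_up l) => [|[y b] w] /=; first by rewrite mul1g.
by case: eqP => [->|_] /=; rewrite !mul1g.
Qed.

Hypothesis sA : is_subgroup A.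
Hypothesis sB : is_subgroup B.

Lemma factor_subgroup s : is_subgroup (factor s).
Proof. by case: s. Qed.

Lemma normal_form1 a b : A a -> B b -> is_normal_form A B [:: (a, b)].
Proof. by move=> Aa Bb; split=> //; split; [case|split; case]. Qed.

Lemma normal_form_replace a a' b w : A a ->
  is_normal_form A B ((a', b) :: w) -> is_normal_form A B ((a, b) :: w).
Proof.
move=> Aa [_ [h1 [h2 h3]]]; split=> //; split; last split.
- by case=> [|i] /= si; [have := h1 0 si => -[]|exact: (h1 i.+1)].
- by case=> // i; exact: (h2 i.+1).
- by case=> [|i] si; [exact: (h3 0)|exact: (h3 i.+1)].
Qed.

Lemma normal_form_cons a b a' b' w : A a -> B b -> b <> 1%g -> a' <> 1%g ->
  is_normal_form A B ((a', b') :: w) ->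
  is_normal_form A B ((a, b) :: (a', b') :: w).
Proof.
move=> Aa Bb b1 a1 [_ [h1 [h2 h3]]]; split=> //; split; last split.
- by case=> [|i] //= si; exact: (h1 i).
- by case=> [|[|i]] // /andP[_ si]; exact: (h2 i.+1).
- by case=> [|i] // si; exact: (h3 i).
Qed.

(** The first component is carried through the induction: its nontriviality allows a B-letter in
    front of an A-letter, and it later tells from which factor the first letter comes. *)
Lemma pair_up_normal_form p l : reduced (p :: l) ->
  is_normal_form A B (pair_up (p :: l)) /\
  (nth (1, 1)%g (pair_up (p :: l)) 0).1 = if p.1 then p.2 else 1%g.
Proof.
have A1 : A 1%g by case: sA.
have B1 : B 1%g by case: sB.
elim: l p => [|q l IH] [[] x]; rewrite reduced_cons => /and3P[/andP[/= xF x1]].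
- by move: xF; rewrite inE => xF _ _; split=> //; exact: normal_form1.
- by move: xF; rewrite inE => xF _ _; split=> //; exact: normal_form1.
- move: xF; rewrite inE => xF rl; rewrite /alternates /=; case: q rl => -[]// y rl _.
  have [nf _] := IH _ rl; move: nf; rewrite /= /pair_letter /= eqxx.
  by move=> nf; split=> //; exact: normal_form_replace nf.
- move: xF; rewrite inE => xF rl; rewrite /alternates /=; case: q rl => -[]// y rl _.
  have [nf nf1] := IH _ rl; have : y != 1%g by move: rl; rewrite reduced_cons => /and3P[/andP[]].
  move: nf nf1 => /=; set w := pair_letter (true, y) _.
  case: w => [[]//|[a' b'] w] nf /= a'y /eqP y1.
  by split=> //; apply: normal_form_cons nf => //; [exact/eqP|rewrite a'y].
Qed.

Hypothesis split : forall g : G, g <> 1%g ->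
  exists! w, is_normal_form A B w /\ nf_prod w = g.

Lemma pair_up_inj p l q t : reduced (p :: l) -> reduced (q :: t) ->
  word_prod (p :: l) <> 1%g -> word_prod (p :: l) = word_prod (q :: t) ->
  pair_up (p :: l) = pair_up (q :: t).
Proof.
move=> rl rt l1 e; have [w [_ wu]] := split l1.
have [nl _] := pair_up_normal_form rl; have [nt _] := pair_up_normal_form rt.
apply: etrans (esym (wu _ _)) (wu _ _); split=> //; first exact: nf_prod_pair_up.
by rewrite nf_prod_pair_up e.
Qed.

Lemma letterV p : letter p -> letter (p.1, p.2^-1%g).
Proof.
case: p => s x; rewrite /letter /= => /andP[]; rewrite inE => xF x1.
rewrite invg_eq1 x1 andbT inE; have [_ [_ sV]] := factor_subgroup s.
exact: sV.
Qed.

(** Uniqueness speaks only of nontrivial elements, so a product equal to 1 is handled through the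
    tail [q :: l]. It would equal the inverse of the letter [p], yet exactly one of the two normal
    forms has a trivial first component, since the tags of [p] and [q] differ. *)
Lemma word_prod_neq1 p l : reduced (p :: l) -> word_prod (p :: l) <> 1%g.
Proof.
move=> rl e; have := rl; rewrite reduced_cons => /and3P[lp].
have p1 : p.2 != 1%g by case/andP: lp.
case: l rl e => [|q l] rl e rq apq; first by move: p1; rewrite -e /= mulg1 eqxx.
have e' : word_prod (q :: l) = word_prod [:: (p.1, p.2^-1%g)].
  by rewrite [RHS]/= mulg1; apply/esym/mulg1_eq; exact: e.
have rV : reduced [:: (p.1, p.2^-1%g)] by rewrite /reduced /= letterV.
have q1 : word_prod (q :: l) <> 1%g.
  by rewrite e' /= mulg1 => /eqP; rewrite invg_eq1 (negbTE p1).
have E := pair_up_inj rq rV q1 e'.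
have [_ nq] := pair_up_normal_form rq; have [_ nV] := pair_up_normal_form rV.
move: nq; rewrite E nV; move: apq rq; rewrite reduced_cons => + /and3P[/andP[_ lq] _ _].
rewrite /alternates; case: {+}p.1; case: {+}q.1 => //= _ /eqP.
  by rewrite invg_eq1 (negbTE p1).
by rewrite eq_sym (negbTE lq).
Qed.

(** A nontrivial [x] is prepended, cancels the first letter, or merges with it; in each case the
    tags still alternate. *)
Lemma reduced_mul_factor s x l : factor s x -> reduced l ->
  exists2 t, reduced t & word_prod t = (x * word_prod l)%g.
Proof.
move=> xF rl; have [x1|x1] := eqVneq x 1%g; first by exists l; rewrite ?x1 ?mul1g.
have lx : letter (s, x) by rewrite /letter /= x1 andbT inE.
case: l rl => [|[s' y] l] rl.
  by exists [:: (s, x)] => //; rewrite /reduced /= lx.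
have [ss|ss] := eqVneq s s'; last by exists [:: (s, x), (s', y) & l]; rewrite // reduced_cons lx rl.
subst s'; move: rl; rewrite reduced_cons => /and3P[/andP[]]; rewrite inE /= => yF y1 rl al.
have [xy1|xy1] := eqVneq (x * y)%g 1%g.
  by exists l; rewrite //= mulgA xy1 mul1g.
exists ((s, (x * y)%g) :: l); last by rewrite /= mulgA.
have xyF : factor s (x * y)%g by have [_ [sM _]] := factor_subgroup s; exact: sM.
rewrite reduced_cons rl /letter /= xy1 mem_set//=.
Qed.

Lemma reduced_word_exists g : exists2 l, reduced l & word_prod l = g.
Proof.
have [->|/eqP g1] := eqVneq g 1%g; first by exists [::].
have [w [[[_ [wF _]] <-] _]] := split g1.
elim: w wF => [|[a b] w IH] wF; first by exists [::].
rewrite /=; have [|l rl <-] := IH; first by move=> i iw; exact: (wF i.+1).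
have [/= Aa Bb] := wF 0 isT.
have [t rt <-] := @reduced_mul_factor false b l Bb rl.
by have [u ru <-] := @reduced_mul_factor true a t Aa rt; exists u.
Qed.

End ReducedWords.

(** * Linear isometric actions *)

Section IsometricAction.
Variables (R : realType) (G : groupType) (E : normedModType R) (act : G -> E -> E).
Hypothesis iso : linear_isometric_action act.

Lemma actP g c u v : act g (c *: u + v) = c *: act g u + act g v.
Proof. by case: iso. Qed.

Lemma norm_act g v : `|act g v| = `|v|.
Proof. by case: iso => _ []. Qed.

Lemma act1 v : act 1%g v = v.
Proof. by case: iso => _ [_ []]. Qed.

Lemma actM g h v : act (g * h)%g v = act g (act h v).
Proof. by case: iso => _ [_ []]. Qed.

Lemma actD g u v : act g (u + v) = act g u + act g v.
Proof. by have := actP g 1 u v; rewrite !scale1r. Qed.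

Lemma act0 g : act g 0 = 0.
Proof. by apply/eqP; rewrite -normr_eq0 norm_act normr0. Qed.

Lemma actZ g c v : act g (c *: v) = c *: act g v.
Proof. by have := actP g c v 0; rewrite act0 !addr0. Qed.

Lemma actN g v : act g (- v) = - act g v.
Proof. by rewrite -scaleN1r actZ scaleN1r. Qed.

Lemma actB g u v : act g (u - v) = act g u - act g v.
Proof. by rewrite actD actN. Qed.

Lemma actK g v : act g (act g^-1%g v) = v.
Proof. by rewrite -actM mulgV act1. Qed.

Lemma act_sum (I : finType) g (F : I -> E) :
  act g (\sum_i F i) = \sum_i act g (F i).
Proof. by apply: (big_morph (act g)); [exact: actD|exact: act0]. Qed.

End IsometricAction.

(** * Split quasicocycles evaluated on reduced words *)

Section SplitQuasicocycles.
Variables (R : realType) (G : groupType) (A B : set G).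
Variables (E : normedModType R) (act : G -> E -> E).
Hypothesis iso : linear_isometric_action act.
Variables fA fB : G -> E.

Definition letter_val (p : bool * G) : E := (if p.1 then fA else fB) p.2.

Definition word_sum (l : seq (bool * G)) : E :=
  foldr (fun p v => letter_val p + act p.2 v) 0 l.

Lemma word_sum_cat l t :
  word_sum (l ++ t) = word_sum l + act (word_prod l) (word_sum t).
Proof.
elim: l => [|p l IH] /=; first by rewrite add0r (act1 iso).
by rewrite IH (actD iso) (actM iso) addrA.
Qed.

Lemma word_sum_rcons l p :
  word_sum (rcons l p) = word_sum l + act (word_prod l) (letter_val p).
Proof. by rewrite -cats1 word_sum_cat /= (act0 iso) addr0. Qed.

Lemma nf_sum_fromE h w : nf_sum_from act fA fB h w = act h (nf_sum act fA fB w).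
Proof.
rewrite /nf_sum; elim: w h => [|[a b] w IH] h /=; first by rewrite (act0 iso).
by rewrite IH [in RHS]IH !(actD iso) -!(actM iso) !mul1g !mulgA mulg1.
Qed.

Hypothesis sA : is_subgroup A.
Hypothesis sB : is_subgroup B.
Hypothesis split : forall g : G, g <> 1%g ->
  exists! w, is_normal_form A B w /\ nf_prod w = g.
Hypothesis altA : alt_quasicocycle_on A act fA.
Hypothesis altB : alt_quasicocycle_on B act fB.

Lemma alternating_at1 (D : set G) (f : G -> E) :
  is_subgroup D -> alt_quasicocycle_on D act f -> f 1%g = 0.
Proof.
move=> [D1 _] [_ /(_ _ D1)]; rewrite invg1 (act1 iso) -mulr2n => /eqP.
by rewrite -scaler_nat scaler_eq0 pnatr_eq0 => /eqP.
Qed.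

(** The trivial components inserted by [pair_up] contribute nothing, since alternating quasicocycles
    vanish at 1. *)
Lemma nf_sum_pair_up l : nf_sum act fA fB (pair_up l) = word_sum l.
Proof.
have fA1 := alternating_at1 sA altA; have fB1 := alternating_at1 sB altB.
elim: l => //= -[[] x] l; rewrite /pair_letter /letter_val /= => <-; last first.
  by rewrite /nf_sum /= nf_sum_fromE fA1 !mul1g !(act1 iso) add0r.
case: (pair_up l) => [|[y b] w] /=.
  by rewrite /nf_sum /= fB1 !(act0 iso) (act1 iso) !addr0.
case: eqP => [->|_]; rewrite /nf_sum /= !nf_sum_fromE ?fA1 ?fB1.
  by rewrite !(actD iso) -!(actM iso) !mul1g !mulg1 (act0 iso) add0r (act1 iso) !addrA.
by rewrite !(actD iso) -!(actM iso) !mul1g !mulg1 !(act0 iso) (act1 iso) addr0 !addrA !mulgA.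
Qed.

(** Normal forms exist away from 1, so the default [[::]] of [xget] is never taken. *)
Definition split_extension (g : G) : E :=
  if g == 1%g then 0
  else nf_sum act fA fB (xget [::] [set w | is_normal_form A B w /\ nf_prod w = g]).

Lemma split_extensionP : is_split_quasicocycle A B act fA fB split_extension.
Proof.
rewrite /split_extension; split; first by rewrite eqxx.
move=> w nw /[dup] w1 /eqP/negbTE ->; have [w0 [_ wu]] := split w1.
congr nf_sum; apply: etrans (esym (wu _ _)) (wu _ _) => //.
by apply: (@xgetPex _ [::] [set v | is_normal_form A B v /\ _]); exists w.
Qed.

Variable F : G -> E.
Hypothesis FP : is_split_quasicocycle A B act fA fB F.

Lemma split_word_sum l : reduced A B l -> F (word_prod l) = word_sum l.
Proof.
case: l => [|p l] rl; first by case: FP.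
have [nf _] := pair_up_normal_form sA sB rl.
have p1 := word_prod_neq1 sA sB split rl.
rewrite -nf_sum_pair_up -(nf_prod_pair_up (p :: l)).
by case: FP => _; apply=> //; rewrite nf_prod_pair_up.
Qed.

(** Nothing cancels or merges where the two words meet, so the letterwise sum splits exactly. *)
Lemma cobound1_split_reduced l t : reduced A B (l ++ t) ->
  cobound1 act F (word_prod l) (word_prod t) = 0.
Proof.
move=> rlt; have [rl rt] := reduced_cat rlt.
by rewrite /cobound1 -word_prod_cat !split_word_sum// word_sum_cat subrr.
Qed.

Lemma letter_val_alt s x : factor A B s x ->
  letter_val (s, x) + act x (letter_val (s, x^-1%g)) = 0.
Proof. by case: s => xF; [case: altA|case: altB] => _; apply. Qed.

Lemma letter_val_bounded : exists M, 0 <= M /\ forall s x y,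
  factor A B s x -> factor A B s y ->
  `|letter_val (s, x) + act x (letter_val (s, y)) - letter_val (s, (x * y)%g)| <= M.
Proof.
have [[[MA hA] _] [[MB hB] _]] := (altA, altB).
exists (Num.max 0 (Num.max MA MB)); split; first by rewrite le_max lexx.
move=> [] x y xF yF; rewrite !le_max.
    by rewrite [_ <= MA]hA ?orbT.
by rewrite [_ <= MB]hB ?orbT.
Qed.

(* Induction on the last letter of the left factor: at each step the letters meeting
   in the middle either belong to distinct factors (defect 0), or cancel (the defect is
   that of shorter words), or merge (the defect is that of f_A or f_B). *)
Lemma split_quasicocycle : quasicocycle_on setT act F.
Proof.
have [M [M0 hM]] := letter_val_bounded.
have F1 : F 1%g = 0 by case: FP.
exists M => g h _ _.
have [l rl <-] := reduced_word_exists sA sB split g.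
have [t rt <-] := reduced_word_exists sA sB split h.
elim/last_ind: l rl t rt => [|l [s x] IH] rl t rt.
  by rewrite /cobound1 /= F1 (act1 iso) mul1g add0r subrr normr0.
case: t rt => [|[s' y] t] rt.
  by rewrite /cobound1 /= F1 (act0 iso) mulg1 addr0 subrr normr0.
have [ss|ss] := eqVneq s s'; last first.
  by rewrite cobound1_split_reduced ?normr0// reduced_rcons_cat.
subst s'; have /reduced_cat[rl0] : reduced A B (l ++ [:: (s, x)]) by rewrite cats1.
move=> /andP[/andP[/andP[/= xF x1] _] _]; rewrite inE in xF.
have := rt; rewrite reduced_cons => /and3P[/andP[/= yF y1] rt0 al]; rewrite inE in yF.
have [xy1|/eqP xy1] := eqVneq (x * y)%g 1%g.
  have -> : cobound1 act F (word_prod (rcons l (s, x))) (word_prod ((s, y) :: t)) =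
            cobound1 act F (word_prod l) (word_prod t); last exact: IH.
  rewrite /cobound1 [F (word_prod (rcons _ _))]split_word_sum//.
  rewrite [F (word_prod (_ :: t))]split_word_sum// word_sum_rcons.
  rewrite -[word_sum l]split_word_sum// word_prod_rcons /= -[word_sum t]split_word_sum//.
  rewrite mulgA -(mulgA _ x) xy1 mulg1; congr (_ - _).
  rewrite -addrA; congr (_ + _); rewrite (actM iso) -(actD iso); congr act.
  rewrite (actD iso) addrA -(actM iso) xy1 (act1 iso).
  have -> : y = x^-1%g by apply/esym/mulg1_eq.
  by rewrite letter_val_alt// add0r.
have xyF : factor A B s (x * y)%g by have [_ [sM _]] := factor_subgroup sA sB s; exact: sM.
have rm : reduced A B (rcons l (s, (x * y)%g) ++ t).
  rewrite -cats1 -catA /=.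
  have lxy : letter A B (s, (x * y)%g) by rewrite /letter /= mem_set//; exact/eqP.
  case: (lastP l) rl rl0 => [|l' q] rl rl0; first by rewrite /= reduced_cons lxy rt0.
  apply: reduced_rcons_cat => //; first by rewrite reduced_cons lxy rt0.
  move: rl; rewrite /reduced => /andP[_]; rewrite -cats1.
  by case: l' {rl0} => [|q' l'] /=; rewrite ?andbT// cat_path last_rcons => /andP[_ /andP[]].
have -> : cobound1 act F (word_prod (rcons l (s, x))) (word_prod ((s, y) :: t)) =
    act (word_prod l) (letter_val (s, x) + act x (letter_val (s, y)) - letter_val (s, (x * y)%g)).
  have -> : cobound1 act F (word_prod (rcons l (s, x))) (word_prod ((s, y) :: t)) =
     word_sum (rcons l (s, x)) + act (word_prod (rcons l (s, x))) (word_sum ((s, y) :: t))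
     - word_sum (rcons l (s, (x * y)%g) ++ t).
    by rewrite -!split_word_sum// /cobound1 word_prod_cat !word_prod_rcons /= !mulgA.
  rewrite word_sum_cat !word_sum_rcons !word_prod_rcons /=.
  rewrite (actB iso) !(actD iso) -!(actM iso) !mulgA.
  rewrite [X in X - _]addrA opprD addrACA subrr addr0.
  by rewrite -[X in X - _]addrA opprD addrACA subrr add0r.
by rewrite (norm_act iso); exact: hM.
Qed.

End SplitQuasicocycles.

(** * Coordinates and compactness in finite dimension *)

Section FiniteDimensional.
Variables (R : realType) (E : normedModType R).

Definition comb n (e : 'I_n -> E) (x : 'rV[R]_n) : E := \sum_i x 0 i *: e i.

Lemma comb_continuous n (e : 'I_n -> E) : continuous (comb e).
Proof.
apply: continuous_big => [|i _ x]; first exact: add_continuous.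
by apply: (@cvgZr_tmp _ _ _ (nbhs x) _ (fun y : 'rV[R]_n => y 0 i)); exact: coord_continuous.
Qed.

Lemma comb_linear n (e : 'I_n -> E) c x y :
  comb e (c *: x + y) = c *: comb e x + comb e y.
Proof.
rewrite /comb scaler_sumr -big_split; apply: eq_bigr => i _.
by rewrite !mxE scalerDl scalerA.
Qed.

Lemma norm_coord n (x : 'rV[R]_n) i : `|x 0 i| <= `|x|.
Proof.
rewrite [leRHS]/Num.norm /= mx_normrE.
by apply: (le_trans _ (@le_bigmax _ _ _ 0 (fun p : 'I_1 * 'I_n => `|x p.1 p.2|) (0, i))).
Qed.

Lemma comb_bound n (e : 'I_n -> E) x : `|comb e x| <= `|x| * \sum_i `|e i|.
Proof.
rewrite mulr_sumr; apply: le_trans (ler_norm_sum _ _ _) _.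
by apply: ler_sum => i _; rewrite normrZ ler_wpM2r// norm_coord.
Qed.

Definition spanned_by n (e : 'I_n -> E) := forall u, exists x, u = comb e x.

Lemma spanned_drop n (e : 'I_n.+1 -> E) (x : 'rV[R]_n.+1) j :
  spanned_by e -> comb e x = 0 -> x 0 j != 0 -> spanned_by (e \o lift j).
Proof.
move=> se ex0 xj u; have [y ->] := se u.
(* Adding a multiple of the relation [x] leaves the combination unchanged and clears coordinate
   [j]. *)
pose z := - (y 0 j / x 0 j) *: x + y.
have -> : comb e y = comb e z by rewrite comb_linear ex0 scaler0 add0r.
exists (\row_i z 0 (lift j i)); rewrite /comb (bigD1_ord j)//=.
rewrite !mxE mulNr divfK// addNr scale0r add0r.
by apply: eq_bigr => i _; rewrite !mxE.
Qed.

(* A spanning family of minimal size is free, so that its combinations are bounded below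
   on the unit sphere of coordinates, which is compact. *)
Lemma bounded_coordinates : finite_dimensional E ->
  exists n (e : 'I_n -> E) (K : R), 0 < K /\
    forall u, exists2 x, u = comb e x & `|x| <= K * `|u|.
Proof.
move=> [s hs].
have ex : exists n, `[< exists e : 'I_n -> E, spanned_by e >].
  exists (size s); apply/asboolP; exists (fun i => nth 0 s i) => u.
  have [c ->] := hs u; exists (\row_i c i).
  by apply: eq_bigr => i _; rewrite mxE.
have [n /asboolP[e se] nmin] := find_ex_minn ex.
have inj x : comb e x = 0 -> x = 0.
  move=> ex0; apply/rowP => j; rewrite mxE; apply/eqP; apply: contraT => xj.
  case: n e se nmin x ex0 j xj => [|n] e se nmin x ex0 j xj; first by case: j {xj}.
  suff /nmin : `[< exists e : 'I_n -> E, spanned_by e >] by rewrite ltnn.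
  by apply/asboolP; exists (e \o lift j); exact: spanned_drop xj.
pose S := [set x : 'rV[R]_n | `|x| = 1].
have cf : continuous (fun x => `|comb e x|).
  move=> x; apply: (@continuous_comp _ _ _ (comb e) (fun v => `|v|)).
    exact: comb_continuous.
  exact: norm_continuous.
suff [m m0 hm] : exists2 m, 0 < m & forall x, S x -> m <= `|comb e x|.
  exists n, e, m^-1; split=> [|u]; first by rewrite invr_gt0.
  have [x ->] := se u; exists x => //.
  have [->|x0] := eqVneq x 0; first by rewrite normr0 mulr_ge0 ?invr_ge0 ?(ltW m0).
  have nx : 0 < `|x| by rewrite normr_gt0.
  have Sx : S (`|x|^-1 *: x).
    by rewrite /S /= normrZ ger0_norm ?invr_ge0// mulVf// gt_eqF.
  have := hm _ Sx; have -> : comb e (`|x|^-1 *: x) = `|x|^-1 *: comb e x.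
    rewrite -[_ *: x]addr0 comb_linear /comb [X in _ + X]big1 ?addr0// => i _.
    by rewrite mxE scale0r.
  rewrite normrZ ger0_norm ?invr_ge0// => h.
  by rewrite ler_pdivlMl// mulrC -ler_pdivlMl//.
(* The sphere is empty when [n = 0]; any positive constant then serves as [m]. *)
have [S0|/set0P/negP/negPn/eqP S0] := pselect (S !=set0); last first.
  by exists 1 => // x; rewrite S0.
have cS : compact S.
  apply: bounded_closed_compact.
    by exists 1; split=> // M M1 x /= ->; exact: ltW.
  apply: (@closed_comp _ _ (fun x : 'rV[R]_n => `|x|) [set 1]) => //.
  by move=> x _; exact: norm_continuous.
have [c cS' cmin] := EVT_min_rV S0 cS (continuous_subspaceT cf).
rewrite inE in cS'; exists `|comb e c|; last first.
  by move=> x Sx; apply: cmin; rewrite inE.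
rewrite normr_gt0; apply/eqP => /inj c0; move: cS'.
by rewrite /S /= c0 normr0 => /eqP; rewrite eq_sym oner_eq0.
Qed.

(** Coordinates can be chosen in the closed ball of radius [K * r], which is compact and has a
    compact image under [comb e]. *)
Lemma bounded_in_compact : finite_dimensional E -> forall r : R,
  exists2 C : set E, compact C & forall u, `|u| <= r -> C u.
Proof.
move=> /bounded_coordinates[n [e [K [K0 hK]]]] r.
exists (comb e @` [set x | `|x| <= K * r]).
  apply: continuous_compact; first by apply: continuous_subspaceT; exact: comb_continuous.
  apply: bounded_closed_compact.
    exists (K * r); split=> [|M rM x /= xr]; first exact: num_real.
    exact/ltW/(le_lt_trans xr).
  apply: (@closed_comp _ _ (fun x : 'rV[R]_n => `|x|) [set y | y <= K * r]) => //.
    by move=> x _; exact: norm_continuous.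
move=> u ur; have [x ux xK] := hK u; exists x; last by rewrite ux.
by apply: le_trans xK _; rewrite ler_wpM2l// ltW.
Qed.

End FiniteDimensional.

(** * Recurrence of powers to the identity *)

(** A bound [d] on the operator norm of [act g - 1], stated vector by vector. *)
Definition near_identity (R : realType) (G : groupType) (E : normedModType R)
  (act : G -> E -> E) (d : R) (g : G) : Prop := forall u, `|act g u - u| <= d * `|u|.

(* The images of a basis under the powers of [a] stay in a compact set, hence come back
   close to each other; as the action is isometric, so do those under a later power. *)
Lemma near_identity_recurrence (R : realType) (G : groupType) (E : normedModType R)
    (act : G -> E -> E) (a : G) :
  linear_isometric_action act -> finite_dimensional E ->
  forall (N : nat) (d : R), 0 < d -> exists2 n, (N < n)%N & near_identity act d (a ^+ n)%g.
Proof.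
move=> iso fd N d d0.
have [n [e [K [K0 hK]]]] := bounded_coordinates fd.
have [C cC hC] := bounded_in_compact fd (\sum_i `|e i|).
pose X (m : nat) : 'rV[E]_n := \row_i act (a ^+ m)%g (e i).
pose D := [set v : 'rV[E]_n | forall i : 'I_n, C (v ord0 i)].
have cD : compact D by exact: (@rV_compact E n (fun=> C)).
have XD m : D (X m).
  move=> i; rewrite mxE; apply: hC; rewrite (norm_act iso).
  by rewrite (bigD1 i)//= lerDl sumr_ge0.
have [|p [_ clp]] := cD (X @ \oo) _; first by exists 0%N => // m _; exact: XD.
(* The two images of each [e i] will differ by at most [2 * r], for a total error of [K * n * 2 * r]
   times the norm of [u]; [n.+1] avoids a division by zero. *)
pose r := d / (K * 2 * n.+1%:R).
have r0 : 0 < r by rewrite divr_gt0// !mulr_gt0.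
have near_p M : exists2 m, (M <= m)%N & ball p r (X m).
  have [|_ [[m Mm <-] pm]] := clp [set X m | m in [set m | (M <= m)%N]] _ _ (nbhsx_ballx p r r0).
    by exists M => // m Mm; exists m.
  by exists m.
have [m _ pm] := near_p 0%N.
(* Starting from [(m + N).+1] forces [m' - m] to exceed [N]. *)
have [m' mm' pm'] := near_p (m + N).+1.
exists (m' - m)%N; first by rewrite ltn_subRL.
move=> u; have -> : `|act (a ^+ (m' - m))%g u - u| = `|act (a ^+ m')%g u - act (a ^+ m)%g u|.
  rewrite -(norm_act iso (a ^+ m)%g) (actB iso) -(actM iso) -expgnDr subnKC//.
  by rewrite (leq_trans _ mm')// leqW// leq_addr.
have [x ux xK] := hK u.
have -> : act (a ^+ m')%g u - act (a ^+ m)%g u =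
    comb (fun i => act (a ^+ m')%g (e i) - act (a ^+ m)%g (e i)) x.
  rewrite [in LHS]ux /comb !(act_sum iso) -sumrB; apply: eq_bigr => i _.
  by rewrite !(actZ iso) scalerBr.
apply: le_trans (comb_bound _ _) _.
have step i : `|act (a ^+ m')%g (e i) - act (a ^+ m)%g (e i)| <= 2 * r.
  have := pm.2 0 i; have := pm'.2 0 i; rewrite !mxE -!ball_normE /= => h' h.
  rewrite -(subrKA (p 0 i)); apply: le_trans (ler_normD _ _) _.
  by rewrite mulr_natl mulr2n lerD// ltW// distrC.
apply: le_trans (_ : K * `|u| * (n%:R * (2 * r)) <= _).
  apply: ler_pM => //; first by apply: sumr_ge0.
  apply: le_trans (ler_sum _ (fun i _ => step i)) _.
  by rewrite sumr_const card_ord [leRHS]mulr_natl.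
have -> : K * `|u| * (n%:R * (2 * r)) = d * `|u| * (n%:R / n.+1%:R).
  by rewrite /r; field; rewrite addrC natr1 pnatr_eq0 (gt_eqF K0).
by rewrite ler_piMr ?mulr_ge0 ?(ltW d0)// ler_pdivrMr// mul1r ler_nat.
Qed.

(** * Bounded functions additive along powers of almost trivial elements *)

Section NearIdentity.
Variables (R : realType) (G : groupType) (E : normedModType R) (act : G -> E -> E).
Hypothesis iso : linear_isometric_action act.

Lemma near_identityM d d' g h : near_identity act d g -> near_identity act d' h ->
  near_identity act (d + d') (g * h)%g.
Proof.
move=> ng nh u; rewrite (actM iso) -(subrKA (act h u)) mulrDl.
apply: le_trans (ler_normD _ _) _; rewrite lerD//.
by apply: le_trans (ng _) _; rewrite (norm_act iso).
Qed.

Lemma near_identity_conj d g h : near_identity act d g ->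
  near_identity act d (h * g * h^-1)%g.
Proof.
move=> ng u; rewrite !(actM iso) -{2}(actK iso h u) -(actB iso) (norm_act iso).
by apply: le_trans (ng _) _; rewrite (norm_act iso).
Qed.

Lemma near_identityV d g : near_identity act d g -> near_identity act d g^-1%g.
Proof.
move=> ng u; rewrite -(norm_act iso g) (actB iso) (actK iso) distrC; exact: ng.
Qed.

Variables (beta : G -> E) (M : R).
Hypothesis betaM : forall g, `|beta g| <= M.

Lemma bound_ge0 : 0 <= M.
Proof. exact: le_trans (normr_ge0 _) (betaM 1%g). Qed.

(* If [beta] is additive along the powers of [h], then [beta (h ^+ n)] differs from
   [n beta h] by at most [n d M]; let [n] tend to infinity. *)
Lemma near_identity_additive (d : R) (h : G) : 0 <= d -> near_identity act d h ->
  (forall n, cobound1 act beta h (h ^+ n.+1)%g = 0) -> `|beta h| <= d * M.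
Proof.
move=> d0 nh addh.
have approx n : `|beta (h ^+ n.+1)%g - n.+1%:R *: beta h| <= n%:R * (d * M).
  elim: n => [|n IH]; first by rewrite expg1 scale1r subrr normr0 mul0r.
  have /eqP := addh n; rewrite subr_eq0 => /eqP; rewrite -expgS => <-.
  rewrite -[n.+2%:R]nat1r scalerDl scale1r opprD addrACA subrr add0r.
  rewrite -(subrKA (beta (h ^+ n.+1)%g)) -[X in _ <= X * _]nat1r mulrDl mul1r.
  apply: le_trans (ler_normD _ _) _; rewrite lerD//.
  by apply: le_trans (nh _) _; rewrite ler_wpM2l.
have bound n : n.+1%:R * `|beta h| <= M + n.+1%:R * (d * M).
  have -> : n.+1%:R * `|beta h| = `|n.+1%:R *: beta h| by rewrite normrZ normr_nat.
  rewrite -[_ *: _](subKr (beta (h ^+ n.+1)%g)).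
  apply: le_trans (ler_normB _ _) _; rewrite lerD//.
  apply: le_trans (approx n) _; rewrite ler_wpM2r ?ler_nat//.
  by rewrite mulr_ge0// bound_ge0.
rewrite leNgt -subr_gt0; apply/negP; set x := `|beta h| - d * M => x0.
have /archi_boundP : 0 <= M / x by rewrite divr_ge0 ?bound_ge0// ltW.
set m := Num.bound _ => nM; have := bound m; rewrite -lerBlDr -mulrBr leNgt => /negP[].
rewrite -ltr_pdivrMr//; apply: lt_le_trans nM _.
by rewrite ler_nat.
Qed.

(** As a product of [a1] and a conjugate of [a2], the element is within [2 * d] of the identity,
    which costs 2 units [d * M]. Removing [a1] in front of the remaining sum, of norm at most
    [3 * M], costs 3 more, and cancelling [beta b] against the term in [beta b^-1] across [a2] costs
    1. *)
Lemma near_identity_commutator (d : R) (a1 a2 b : G) : 0 <= d ->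
  near_identity act d a1 -> near_identity act d a2 ->
  beta b + act b (beta b^-1%g) = 0 ->
  beta (a1 * (b * (a2 * b^-1)))%g =
    beta a1 + act a1 (beta b + act b (beta a2 + act a2 (beta b^-1%g))) ->
  (forall n, cobound1 act beta (a1 * (b * (a2 * b^-1)))%g
               ((a1 * (b * (a2 * b^-1))) ^+ n.+1)%g = 0) ->
  `|beta a1 + act b (beta a2)| <= d * M *+ 6.
Proof.
move=> d0 n1 n2 altb; set W := (a1 * _)%g; set y := (X in act a1 X) => eW addW.
have nW : near_identity act (d + d) W.
  have -> : W = (a1 * (b * a2 * b^-1))%g by rewrite /W !mulgA.
  by apply: near_identityM => //; exact: near_identity_conj.
have W2 : `|beta W| <= d * M *+ 2.
  by rewrite mulr2n -mulrDl; apply: near_identity_additive => //; exact: addr_ge0.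
have y1 : `|y - act b (beta a2)| <= d * M.
  have -> : y - act b (beta a2) = act b (act a2 (beta b^-1%g) - beta b^-1%g).
    rewrite /y (actD iso) [_ + (_ + act b (act _ _))]addrCA addrAC subrr add0r.
    by move/eqP: altb; rewrite addr_eq0 => /eqP ->; rewrite (actB iso) addrC.
  by rewrite (norm_act iso); apply: le_trans (n2 _) _; rewrite ler_wpM2l.
have y3 : `|y| <= M *+ 3.
  apply: le_trans (ler_normD _ _) _; rewrite (norm_act iso) mulrS lerD//.
  by apply: le_trans (ler_normD _ _) _; rewrite (norm_act iso) mulr2n lerD.
clearbody y; have -> : beta a1 + act b (beta a2) = beta W - (act a1 y - y) - (y - act b (beta a2)).
  by rewrite eW !opprB [y - _]addrC [_ - y]addrC !addrA !addrK.
apply: le_trans (ler_normB _ _) _; rewrite (mulrSr _ 5) lerD//.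
apply: le_trans (ler_normB _ _) _; rewrite (mulrnDr _ 2 3) lerD//.
by apply: le_trans (n1 _) _; rewrite -mulrnAr ler_wpM2l.
Qed.

End NearIdentity.

(** * Smallness of the comparison function at almost trivial letters *)

Section Comparison.
Variables (R : realType) (G : groupType) (A B : set G).
Variables (E : normedModType R) (act : G -> E -> E).
Hypothesis iso : linear_isometric_action act.
Variables (beta : G -> E) (M : R).
Hypothesis betaM : forall g, `|beta g| <= M.
Hypothesis beta_reduced : forall l t, reduced A B (l ++ t) ->
  cobound1 act beta (word_prod l) (word_prod t) = 0.
Hypothesis beta_alt : forall s x, letter A B (s, x) -> beta x + act x (beta x^-1%g) = 0.
Hypothesis sA : is_subgroup A.
Hypothesis sB : is_subgroup B.

(* [beta] is additive along the powers of [a1 b a2 b^-1], and [b] and [b^-1] cancel when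
   [a1] and [a2] act almost trivially; take [a1 = a] and [a1 = a^-1]. *)
Lemma near_identity_small (d : R) (a b : G) : 0 <= d -> near_identity act d a ->
  letter A B (true, a) -> letter A B (false, b) -> `|beta a| <= d * M *+ 7.
Proof.
move=> d0 na la lb.
have lV p : letter A B p -> letter A B (p.1, p.2^-1%g) by exact: letterV.
have naV := near_identityV iso na.
have comm a1 : letter A B (true, a1) -> near_identity act d a1 ->
    `|beta a1 + act b (beta a)| <= d * M *+ 6.
  move=> l1 n1.
  pose w := [:: (true, a1); (false, b); (true, a); (false, b^-1%g)].
  have rw : reduced A B w by rewrite /reduced /= l1 lb la (lV _ lb).
  pose pw n := flatten (nseq n w).
  (* [w] starts with an A-letter and ends with a B-letter, so its copies concatenate to a reduced
     word. *)
  have rpw n : reduced A B (pw n).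
    elim: n => [//|n IH]; rewrite -[pw n.+1]/(rcons [:: (true, a1); (false, b); (true, a)]
      (false, b^-1%g) ++ pw n).
    case: n IH => [|n] IH; first by rewrite cats0.
    exact: reduced_rcons_cat.
  have ppw n : word_prod (pw n) = (word_prod w ^+ n)%g.
    elim: n => [//|n IH]; have -> : pw n.+1 = w ++ pw n by [].
    by rewrite word_prod_cat IH -expgS.
  have ew : word_prod w = (a1 * (b * (a * b^-1)))%g by rewrite /= mulg1.
  have step p t : reduced A B (p :: t) ->
      beta (p.2 * word_prod t)%g = beta p.2 + act p.2 (beta (word_prod t)).
    move=> rpt; have /eqP := @beta_reduced [:: p] t rpt.
    by rewrite /cobound1 /= mulg1 subr_eq0 => /eqP.
  apply: (near_identity_commutator iso betaM d0 n1 na); first exact: beta_alt lb.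
    have r3 : reduced A B [:: (false, b); (true, a); (false, b^-1%g)].
      by move: rw; rewrite /w reduced_cons => /and3P[].
    have r2 : reduced A B [:: (true, a); (false, b^-1%g)].
      by move: r3; rewrite reduced_cons => /and3P[].
    by rewrite -ew (step _ _ rw) (step _ _ r3) (step _ _ r2) /= mulg1.
  move=> n; rewrite -ew -ppw; apply: beta_reduced; exact: (rpw n.+2).
have c1 := comm _ la na; have c2 := comm _ (lV _ la) naV.
have c3 : `|beta a + beta a^-1%g| <= d * M.
  have /eqP := beta_alt la; rewrite addr_eq0 => /eqP ->.
  by rewrite addrC -normrN opprD opprK addrC; apply: le_trans (na _) _; rewrite ler_wpM2l.
(* The errors 6 + 6 + 1 are rounded up to 14, so that halving gives 7. *)
have : `|beta a *+ 2| <= d * M *+ 14.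
  have -> : beta a *+ 2 = beta a + act b (beta a) - (beta a^-1%g + act b (beta a))
             + (beta a + beta a^-1%g).
    by rewrite opprD [X in X + _]addrACA subrr addr0 -addrA [beta a + beta _]addrC addKr mulr2n.
  apply: le_trans (ler_normD _ _) _.
  apply: (@le_trans _ _ (d * M *+ 6 + d * M *+ 6 + d * M)).
    by rewrite lerD//; apply: le_trans (ler_normB _ _) _; rewrite lerD.
  rewrite -mulrnDr -mulrSr ler_wpMn2l//; apply: mulr_ge0 => //.
  exact: bound_ge0 betaM.
by rewrite normrMn (mulrnA _ 7 2) ler_pMn2r.
Qed.

End Comparison.

(** * Alternating functions built from indicators *)

Section AlternatingIndicator.
Variables (R : realType) (G : groupType) (E : normedModType R) (act : G -> E -> E).
Hypothesis iso : linear_isometric_action act.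

(** Antisymmetrization without the factor 1/2: the value is exactly [v] at an element of [T] whose
    inverse lies outside [T]. *)
Definition alt_indicator (T : set G) (v : E) (g : G) : E :=
  (if g \in T then v else 0) - act g (if g^-1%g \in T then v else 0).

Lemma alt_indicator_quasicocycle D T v :
  alt_quasicocycle_on D act (alt_indicator T v).
Proof.
have h (b : bool) : `|if b then v else 0| <= `|v| by case: b; rewrite ?normr0.
have bound g : `|alt_indicator T v g| <= `|v| + `|v|.
  by apply: le_trans (ler_normB _ _) _; rewrite (norm_act iso) lerD.
split=> [|g _].
  exists (`|v| + `|v| + (`|v| + `|v|) + (`|v| + `|v|)) => g k _ _.
  apply: le_trans (ler_normB _ _) _; rewrite lerD//.
  by apply: le_trans (ler_normD _ _) _; rewrite (norm_act iso) lerD.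
by rewrite /alt_indicator invgK (actB iso) (actK iso) addrA subrK subrr.
Qed.

End AlternatingIndicator.

(** * Sparse exponents and independence of the split classes *)

(** Recurrence is iterated, each time beyond twice the previous exponent: then no [(N l).*2] is
    again a term of the sequence. *)
Lemma sparse_near_identity (R : realType) (G : groupType) (E : normedModType R)
    (act : G -> E -> E) (a : G) :
  linear_isometric_action act -> finite_dimensional E ->
  exists N : nat -> nat, [/\ forall j, (0 < N j)%N,
    forall i j, (i < j)%N -> ((N i).*2 < N j)%N &
    forall j, near_identity act j.+1%:R^-1 (a ^+ N j)%g].
Proof.
move=> iso fd.
have [f fP] : {f : nat * nat -> nat & forall p, (p.1 < f p)%N /\
    near_identity act p.2.+1%:R^-1 (a ^+ f p)%g}.
  apply: (@choice _ _ (fun p n => (p.1 < n)%N /\ near_identity act p.2.+1%:R^-1 (a ^+ n)%g)) => p.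
  have [|n] := near_identity_recurrence a iso fd p.1 (d := p.2.+1%:R^-1).
    by rewrite invr_gt0.
  by exists n.
pose N := fix N j := if j is i.+1 then f ((N i).*2, j) else f (0%N, 0%N).
have Npos j : (0 < N j)%N.
  by case: j => [|j]; [have [] := fP (0, 0)%N|apply: leq_ltn_trans (fP ((N j).*2, j.+1)).1].
exists N; split=> // [i j|[|j]]; last 2 first.
- by have [] := fP (0, 0)%N.
- by have [] := fP ((N j).*2, j.+1).
elim: j => // j IH; rewrite ltnS leq_eqVlt => /orP[/eqP ->|/IH h].
  exact: (fP ((N j).*2, j.+1)).1.
apply: ltn_trans h _; apply: leq_ltn_trans (fP ((N j).*2, j.+1)).1 => /=.
by rewrite -addnn leq_addr.
Qed.

Lemma expg_inj_infinite_order (G : groupType) (a : G) :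
  (forall n : nat, (0 < n)%N -> (a ^+ n)%g <> 1%g) -> injective (fun n => a ^+ n)%g.
Proof.
move=> ainf m n; wlog mn : m n / (m <= n)%N.
  by move=> H; case: (leqP m n) => [|/ltnW] h e; [exact: H|apply/esym/H].
move=> e; apply/eqP; rewrite eqn_leq mn leqNgt; apply/negP => lmn.
apply: (ainf (n - m)%N); first by rewrite subn_gt0.
by rewrite expgnFr// e mulgV.
Qed.

(* Infinite-dimensionality of the span of split classes in H^2_b(G,E):
   for every k there are k split classes omega_{F_0},...,omega_{F_{k-1}}
   that are linearly independent in H^2_b, i.e. no nontrivial linear
   combination of the bounded cocycles dF_i is the coboundary of a bounded
   1-cochain. *)
Theorem theorem2p2 (R : realType) (G : groupType) (A B : set G)
    (E : completeNormedModType R) (act : G -> E -> E) :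
  finitely_generated G ->
  free_product_splitting A B ->
  nontrivial_subgroup A -> nontrivial_subgroup B ->
  has_infinite_order_element A ->
  linear_isometric_action act ->
  finite_dimensional E ->
  (exists v : E, v <> 0) ->
  forall k : nat,
    exists fA fB F : 'I_k -> G -> E,
      (forall i, alt_quasicocycle_on A act (fA i) /\
                 alt_quasicocycle_on B act (fB i) /\
                 is_split_quasicocycle A B act (fA i) (fB i) (F i) /\
                 quasicocycle_on setT act (F i)) /\
      (forall c : 'I_k -> R,
         (exists beta : G -> E, bounded1 beta /\
            forall g h : G,
              \sum_(i < k) c i *: cobound1 act (F i) g h = cobound1 act beta g h) ->
         forall i, c i = 0).
Proof.
move=> _ [sA [sB split]] _ [b [Bb /eqP b1]] [a [Aa ainf]] iso fd [v v0] k.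
have ainj := expg_inj_infinite_order ainf.
have [N [Npos Ngrow Nnear]] := sparse_near_identity a iso fd.
pose T (i : 'I_k) : set G := [set g | exists m, g = (a ^+ N (m * k + i)%N)%g].
pose fA i := alt_indicator act (T i) v.
(* This is the zero function, written as an indicator so that it is known to be alternating. *)
pose fB (_ : 'I_k) : G -> E := alt_indicator act set0 v.
pose F i := split_extension A B act (fA i) (fB i).
have altA i : alt_quasicocycle_on A act (fA i) by exact: alt_indicator_quasicocycle.
have altB i : alt_quasicocycle_on B act (fB i) by exact: alt_indicator_quasicocycle.
have FP i : is_split_quasicocycle A B act (fA i) (fB i) (F i) by exact: split_extensionP.
exists fA, fB, F; split=> [i|c [beta [[M betaM] eqd]] i].
  by split=> //; split=> //; split=> //; exact: split_quasicocycle (FP i).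
have Fword j l : reduced A B l -> F j (word_prod l) = word_sum act (fA j) (fB j) l.
  exact: split_word_sum (FP j) l.
have Fletter j s x : letter A B (s, x) -> F j x = letter_val (fA j) (fB j) (s, x).
  move=> lx; have := @Fword j [:: (s, x)]; rewrite /reduced /= lx => /(_ isT).
  by rewrite mulg1 (act0 iso) addr0.
have beta_reduced l t : reduced A B (l ++ t) ->
    cobound1 act beta (word_prod l) (word_prod t) = 0.
  move=> rlt; rewrite -eqd big1// => j _.
  by rewrite (cobound1_split_reduced iso sA sB split (altA j) (altB j) (FP j))// scaler0.
have beta1 : beta 1%g = 0.
  have := @beta_reduced [::] [::] isT.
  by rewrite /cobound1 /= (act1 iso) mul1g addrK.
(* Each [F j] is alternating on letters and vanishes at 1, so its defect at [x] and [x^-1] is 0; the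
   defect of [beta] inherits this. *)
have beta_alt s x : letter A B (s, x) -> beta x + act x (beta x^-1%g) = 0.
  move=> lx; have lV := letterV sA sB lx.
  suff : cobound1 act beta x x^-1%g = 0 by rewrite /cobound1 mulgV beta1 subr0.
  rewrite -eqd big1// => j _; rewrite /cobound1 mulgV (Fletter _ _ _ lx) (Fletter _ _ _ lV).
  have xF : factor A B s x by case/andP: lx => /=; rewrite inE.
  rewrite (letter_val_alt (altA j) (altB j) xF).
  by have [-> _] := FP j; rewrite subrr scaler0.
have lb : letter A B (false, b) by rewrite /letter /= mem_set.
have la n : (0 < n)%N -> letter A B (true, a ^+ n)%g.
  move=> n0; rewrite /letter /= mem_set; last first.
    elim: n {n0} => [|n IH]; first by case: sA.
    by rewrite expgS; have [_ [sM _]] := sA; exact: sM.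
  by apply/eqP; exact: ainf.
(* By infinite order, the inverse of [a ^+ n] is no power of [a] with positive exponent, so the
   second term of the indicator vanishes. *)
have fAE n j : fA j (a ^+ n)%g = if (a ^+ n)%g \in T j then v else 0.
  suff aV : ((a ^+ n)^-1%g \in T j) = false by rewrite /fA /alt_indicator aV (act0 iso) subr0.
  apply/negbTE/negP; rewrite inE => -[m e]; apply: (ainf (n + N (m * k + j)%N)%N).
    by rewrite addn_gt0 Npos orbT.
  by rewrite expgnDr -e mulgV.
have FE n j : (0 < n)%N -> F j (a ^+ n)%g = if (a ^+ n)%g \in T j then v else 0.
  by move=> n0; rewrite (Fletter _ _ _ (la n n0)) -fAE.
have Nlt p q : (p < q)%N -> (N p < N q)%N.
  by move=> /Ngrow; apply: leq_trans; rewrite ltnS -addnn leq_addr.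
have Ninj : injective N.
  by move=> p q e; have [/Nlt|/Nlt|//] := ltngtP p q; rewrite e ltnn.
have inT m j : ((a ^+ N (m * k + i)%N)%g \in T j) = (j == i).
  apply/idP/eqP => [|->]; last by rewrite inE; exists m.
  rewrite inE => -[m' /ainj/Ninj e]; apply/ord_inj.
  by rewrite -(modn_small (ltn_ord j)) -(modnMDl m') -e modnMDl modn_small.
have notinT l j : ((a ^+ (N l).*2)%g \in T j) = false.
  apply/negbTE/negP; rewrite inE => -[m' /ainj]; set l' := (m' * k + j)%N => e.
  have [/Ngrow|] := ltnP l l'; first by rewrite e ltnn.
  rewrite leq_eqVlt => /orP[/eqP el|/Nlt]; last by rewrite -e ltnNge -addnn leq_addr.
  move: e; rewrite el => /eqP; rewrite -addnn -[X in _ == X]addn0 eqn_add2l => /eqP Nl.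
  by have := Npos l; rewrite Nl.
set x := `|c i| * `|v|.
(* The right-hand side does not depend on [m], so letting [m] grow forces [x = 0]. *)
have xle m : m.+1%:R * x <= M *+ 28 + x.
  set l := (m * k + i)%N; set n := N l; set d : R := l.+1%:R^-1.
  have d0 : 0 < d by rewrite invr_gt0.
  have nd : near_identity act d (a ^+ n)%g by exact: Nnear.
  have n0 : (0 < n)%N by exact: Npos.
  have small u (d' : R) : 0 <= d' -> letter A B (true, u) -> near_identity act d' u ->
      `|beta u| <= d' * M *+ 7.
    move=> d'0 lu nu.
    exact: (near_identity_small iso betaM beta_reduced beta_alt sA sB d'0 nu lu lb).
  have defect : cobound1 act beta (a ^+ n)%g (a ^+ n)%g = c i *: (v + act (a ^+ n)%g v).
    rewrite -eqd (bigD1 i)//= big1 ?addr0 => [|j ji];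
      rewrite /cobound1 -expgnDr addnn !FE ?double_gt0// notinT inT.
      by rewrite eqxx subr0.
    by rewrite (negbTE ji) (act0 iso) addr0 subr0 scaler0.
  have le1 := small _ _ (ltW d0) (la n n0) nd.
  have le2 : `|beta (a ^+ (n + n))%g| <= d * M *+ 14.
    (* The square of [a ^+ n] is within [2 * d] of the identity, whence 14 = 2 * 7. *)
    rewrite (mulrnA _ 2 7) mulr2n -mulrDl; apply: small; first by rewrite addr_ge0// ltW.
      by apply: la; rewrite addn_gt0 n0.
    by rewrite expgnDr; exact: near_identityM.
  have le3 : `|c i *: (v + act (a ^+ n)%g v)| <= d * M *+ 28.
    rewrite -defect /cobound1 -expgnDr (mulrnDr _ 14 14) (le_trans (ler_normB _ _))// lerD//.
    by rewrite (mulrnDr _ 7 7) (le_trans (ler_normD _ _))// (norm_act iso) lerD.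
  (* Replacing [act (a ^+ n) v] by [v] costs [d * x]. *)
  have le4 : x *+ 2 <= d * (M *+ 28 + x).
    have -> : x *+ 2 = `|c i *: (v *+ 2)| by rewrite normrZ normrMn mulrnAr.
    have -> : v *+ 2 = v + act (a ^+ n)%g v - (act (a ^+ n)%g v - v).
      by rewrite opprB addrCA addrK mulr2n.
    rewrite scalerBr mulrDr mulrnAr (le_trans (ler_normB _ _))// lerD//.
    by rewrite normrZ mulrCA ler_wpM2l.
  have le5 : l.+1%:R * x <= M *+ 28 + x.
    rewrite -ler_pdivlMl ?ltr0n// (le_trans _ le4)// mulr2n lerDl.
    by rewrite mulr_ge0.
  (* Here [m <= l] because [k] is positive, [i] being an element of ['I_k]. *)
  apply: le_trans le5; rewrite ler_wpM2r ?mulr_ge0// ler_nat ltnS.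
  apply: leq_trans (leq_addr _ _); rewrite leq_pmulr//.
  exact: leq_ltn_trans (ltn_ord i).
have : x == 0.
  rewrite eq_le mulr_ge0// andbT leNgt; apply/negP => x0.
  have C0 : 0 <= M *+ 28 + x by rewrite addr_ge0 ?(ltW x0)// mulrn_wge0// (bound_ge0 betaM).
  have /archi_boundP : 0 <= (M *+ 28 + x) / x by rewrite divr_ge0// ltW.
  rewrite ltr_pdivrMr// ltNge => /negP[]; apply: le_trans (xle _).
  by rewrite ler_wpM2r ?ler_nat ?(ltW x0).
by rewrite mulf_eq0 !normr_eq0 => /orP[/eqP|/eqP /v0].
Qed.
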